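(* Let $b=b(N)$ be a sequence of positive integers such that $b(N)\ge\log N$ for all $N$. Let $R_N$ be an $N\times N$ matrix satisfying $\|R_N\|\le g(N)$, where for all $N$ we assume that $g(N)<\frac{1}{3b\sqrt N}$. Then $$\rho(T_{b,N}+R_N)\le (N g(N))^{1/b}+o(1),$$ where $\rho(M)$ denotes the spectral radius of a matrix $M$, and $o(1)$ denotes a small quantity tending to zero as $N\to\infty$.
   Context: The spectral radius of a matrix is the maximum absolute value of its eigenvalues. $\|A\|=\mathrm{tr}(A^*A)^{1/2}$ denotes the Hilbert–Schmidt norm. For a positive integer $b$, $T_{b,N}$ is the $N\times N$ block diagonal matrix in which each $(b+1)\times(b+1)$ diagonal block equals $T_{b+1}$, where $T_{m}$ is the $m\times m$ nilpotent matrix with ones at entries $(i,i+1)$, $1\le i\le m-1$, and zeros elsewhere; if $b+1$ does not divide $N$, a block of zeros is inserted at the bottom of the diagonal. Thus all entries of $T_{b,N}$ are zero except on the superdiagonal (entries $(i,i+1)$, $1\le i\le N-1$), which equals $(\underbrace{1,\dots,1}_{b},0,\underbrace{1,\dots,1}_{b},0,\dots,\underbrace{1,\dots,1}_{b},\underbrace{0,\dots,0}_{\le b})$; there are $\lfloor N/(b+1)\rfloor$ nonzero blocks. *)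

(* Defs.v *)
From mathcomp Require Import all_boot all_order all_algebra.
From mathcomp Require Import complex.
From mathcomp Require Import all_classical all_reals all_analysis.

Set Implicit Arguments.
Unset Strict Implicit.
Unset Printing Implicit Defensive.

Import Order.TTheory GRing.Theory Num.Theory.
Import numFieldNormedType.Exports.

Local Open Scope classical_set_scope.
Local Open Scope ring_scope.
Local Open Scope complex_scope.
Local Open Scope sesquilinear_scope.

(* On R[i] the norm `|z| is itself an element of R[i] with zero imaginary
   part, hence the projection [complex.Re]. *)
Definition cabs (R : realType) (z : R[i]) : R := complex.Re `|z|.

(* The [sup] is a maximum as soon as 0 < n: see [spectral_radius_max]. *)
Definition spectral_radius (R : realType) (n : nat) (A : 'M[R[i]]_n) : R :=
  sup [set cabs a | a in [set a | eigenvalue A a]].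

(* The trace of A^* A is a nonnegative real, so [complex.Re] is harmless. *)
Definition hs_norm (R : realType) (n : nat) (A : 'M[R[i]]_n) : R :=
  Num.sqrt (complex.Re (\tr (A ^t* *m A))).

Definition nilT (R : realType) (m : nat) : 'M[R[i]]_m :=
  \matrix_(i, j) (j == i.+1 :> nat)%:R.

(* The diagonal blocks have size b.+1: indices i and j lie in the same complete
   block when they have the same quotient by b.+1 and this quotient is less
   than N %/ b.+1, and their positions inside that block are the remainders. *)
Definition blockT (R : realType) (b N : nat) : 'M[R[i]]_N :=
  \matrix_(i, j)
    if (i %/ b.+1 == j %/ b.+1)%N && (i %/ b.+1 < N %/ b.+1)%N
    then nilT R b.+1 (inord (i %% b.+1)) (inord (j %% b.+1))
    else 0.

Lemma cabs_ge0 (R : realType) (z : R[i]) : 0 <= cabs z.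
Proof. by rewrite /cabs normc_def /= sqrtr_ge0. Qed.

Lemma spectral_radius_max (R : realType) (n : nat) (A : 'M[R[i]]_n) :
  (0 < n)%N ->
  (exists2 a, eigenvalue A a & cabs a = spectral_radius A) /\
  (forall a, eigenvalue A a -> cabs a <= spectral_radius A).
Proof.
move=> n0; have [r Er] := closed_field_poly_normal (char_poly A).
have mem a : eigenvalue A a = (a \in r).
  rewrite eigenvalue_root_char Er rootZ ?root_prod_XsubC //.
  by rewrite (monicP (char_poly_monic A)) oner_neq0.
have r0 : r != [::].
  apply: contraTneq n0 => r0; have := size_char_poly A.
  rewrite Er r0 big_nil (monicP (char_poly_monic A)) scale1r size_poly1.
  by case=> <-.
have {r0} [a ar amax] : exists2 a, a \in r &
    forall c, c \in r -> cabs c <= cabs a.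
  elim: {Er mem} r r0 => // x [|y s] IH _.
    by exists x; rewrite ?mem_head // => c; rewrite inE => /eqP->.
  have [//|a as_ amax] := IH.
  have [xa|ax] := leP (cabs x) (cabs a).
    exists a; first by rewrite inE as_ orbT.
    by move=> c; rewrite inE => /predU1P[->//|/amax].
  exists x; first exact: mem_head.
  move=> c; rewrite inE => /predU1P[->//|/amax ca].
  exact: le_trans ca (ltW ax).
have E : spectral_radius A = cabs a.
  apply/eqP; rewrite eq_le; apply/andP; split.
    apply: ge_sup; first by exists (cabs a), a => //=; rewrite mem.
    by move=> _ [c /= ec <-]; apply: amax; rewrite -mem.
  apply: ub_le_sup; last by exists a => //=; rewrite mem.
  by exists (cabs a) => _ [c /= ec <-]; apply: amax; rewrite -mem.
by split; [exists a; rewrite ?mem | move=> c; rewrite mem E => /amax].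
Qed.

(* Main.v *)
Require Import Defs.
From mathcomp Require Import all_boot all_order all_algebra.
From mathcomp Require Import complex.
From mathcomp Require Import all_classical all_reals all_analysis.
From mathcomp Require Import zify lra.

Import Order.TTheory GRing.Theory Num.Theory.
Import numFieldNormedType.Exports.

Local Open Scope classical_set_scope.
Local Open Scope ring_scope.
Local Open Scope complex_scope.

(** Write T for the block shift, E for the perturbation and r for the spectral
radius of T + E. If v is a row eigenvector for an eigenvalue a, so that
a v = v T + v E, then iterating this relation gives, for every m,
  a^m v = v T^m + sum_(k < m) a^(m-1-k) (v E) T^k.
When T^m = 0 the first term vanishes. Since T only moves or deletes
coordinates, it does not increase Euclidean norms, and v E has norm at most
|E| |v| by Cauchy-Schwarz; taking norms and choosing |a| = r yields
  r^m <= |E| (1 + r + ... + r^(m-1))            ([spectral_radius_pow_le]).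

Take m = b + 1, for which T^m = 0. The bound on g makes (b+1) g < 1, and this
excludes r >= 1, because then the right-hand side is at most (b+1) g r^(b+1).
Hence r < 1 and r^(b+1) <= (b+1) g ([pow_le_lt1]). If b + 1 <= N this is at
most N g. Replacing the exponent 1/(b+1) by 1/b then costs no more than 1/b
([root_gap]): a number r in [0,1) with r^(b+1) <= s^b satisfies r <= s + 1/b.
If b + 1 > N there is no complete block, T = 0, and m = 1 gives
r <= g <= 1/b directly. In both cases the error is at most 1/b, which tends to
0 as b >= log N. *)

(** * The Euclidean norm of complex row vectors *)

(** Valued in the field itself, where the Cauchy-Schwarz and triangle
inequalities for [dotmx] live; its values are nonnegative, hence real. *)
Definition l2norm (C : numClosedFieldType) n (u : 'rV[C]_n) : C :=
  sqrtC (dotmx u u).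
Arguments l2norm {C n} u.

Lemma l2norm_ge0 (C : numClosedFieldType) n (u : 'rV[C]_n) : 0 <= l2norm u.
Proof. exact: sqrt_dnorm_ge0. Qed.

Lemma sqr_l2norm (C : numClosedFieldType) n (u : 'rV[C]_n) :
  l2norm u ^+ 2 = \sum_i `|u 0 i| ^+ 2.
Proof.
rewrite sqrtCK dotmxE mxE; apply: eq_bigr => i _.
by rewrite !mxE normCK.
Qed.

Lemma l2normD (C : numClosedFieldType) n (u v : 'rV[C]_n) :
  l2norm (u + v) <= l2norm u + l2norm v.
Proof. exact: (triangle_lerif (@dotmx C n)). Qed.

Lemma l2normZ (C : numClosedFieldType) n a (u : 'rV[C]_n) :
  l2norm (a *: u) = `|a| * l2norm u.
Proof.
apply/eqP; rewrite -(@eqrXn2 _ 2) ?mulr_ge0 ?l2norm_ge0//.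
rewrite exprMn !sqr_l2norm mulr_sumr; apply/eqP/eq_bigr => i _.
by rewrite mxE normrM exprMn.
Qed.

(** Each entry of [u *m A] is the scalar product of [u] with the conjugate of a
column of [A]; Cauchy-Schwarz, summed over the columns, shows that the operator
norm is at most the Hilbert-Schmidt norm. *)
Lemma sqr_l2norm_mulmx_le (C : numClosedFieldType) n (u : 'rV[C]_n)
    (A : 'M[C]_n) :
  l2norm (u *m A) ^+ 2 <=
    l2norm u ^+ 2 * \sum_j \sum_i `|A i j| ^+ 2.
Proof.
rewrite sqr_l2norm mulr_sumr; apply: ler_sum => j _.
have -> : (u *m A) 0 j = dotmx u (map_mx Num.conj (col j A)^T).
  by rewrite dotmxE !mxE; apply: eq_bigr => i _; rewrite !mxE conjCK.
apply: le_trans (CauchySchwarz (@dotmx C n) _ _) _.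
rewrite -[X in _ * X]sqrtCK -[X in X * _]sqrtCK -!/(l2norm _).
rewrite [X in _ * X]sqr_l2norm.
by under eq_bigr do rewrite !mxE norm_conjC.
Qed.

(** The matrix of a partial injection moves some coordinates of a vector to
distinct places and erases the others, so it is a contraction. *)
Lemma l2norm_partial_perm_le (C : numClosedFieldType) n (e : rel 'I_n)
    (A : 'M[C]_n) (u : 'rV[C]_n) :
  (forall i j j', e i j -> e i j' -> j = j') ->
  (forall i i' j, e i j -> e i' j -> i = i') ->
  (forall i j, A i j = (e i j)%:R) ->
  l2norm (u *m A) <= l2norm u.
Proof.
move=> er ec Ae; rewrite -ler_sqr ?nnegrE ?l2norm_ge0// !sqr_l2norm.
(* Column [j] has at most one nonzero entry, so no cross terms appear. *)
have E j : `|(u *m A) 0 j| ^+ 2 = \sum_i `|u 0 i| ^+ 2 * (e i j)%:R.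
  rewrite mxE; under eq_bigr do rewrite Ae.
  case: (pickP (e^~ j)) => /= [i eij|e0]; last first.
    by rewrite !big1 ?normr0 ?expr0n// => i _; rewrite e0 mulr0.
  have ne k : k != i -> e k j = false.
    by apply: contra_neqF => /ec; apply.
  rewrite (bigD1 i)//= [in RHS](bigD1 i)//= eij !mulr1.
  by rewrite !big1 ?addr0// => k /ne ekj; rewrite ekj mulr0.
under eq_bigr do rewrite E.
rewrite exchange_big/=; apply: ler_sum => i _; rewrite -mulr_sumr.
rewrite -[leRHS]mulr1 ler_wpM2l ?exprn_ge0//.
case: (pickP (e i)) => /= [j eij|e0]; last first.
  by rewrite big1 ?ler01// => j _; rewrite e0.
rewrite (bigD1 j)//= big1 ?eij ?addr0// => k.
by case eik: (e i k) => //; rewrite (er _ _ _ eik eij) eqxx.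
Qed.

(** * Perturbing a nilpotent contraction *)

(** A nonzero coefficient of [A ^+ k] comes from a chain of [k] nonzero
coefficients of [A], along which the height [h] grows by at least [k]; heights
below [m] leave no room for a chain of length [m]. *)
Lemma graded_nilpotent (K : pzRingType) n (A : 'M[K]_n) (h : 'I_n -> nat) m :
  (forall i, h i < m)%N ->
  (forall i j, A i j != 0 -> (h i < h j)%N) -> A ^+ m = 0.
Proof.
move=> hm hA.
have H k i j : (A ^+ k) i j != 0 -> (h i + k <= h j)%N.
  elim: k j => [|k IH] j.
    rewrite expr0 mxE addn0; case: (eqVneq i j) => [->//|_].
    by rewrite mulr0n eqxx.
  rewrite exprSr mxE => /eqP; apply: contra_notP => /negP.
  rewrite -ltnNge => lt.
  apply: big1 => l _; apply/eqP; move: lt; apply: contraTT => nz.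
  have kl : (A ^+ k) i l != 0 by apply: contraNneq nz => ->; rewrite mul0r.
  have lj : A l j != 0 by apply: contraNneq nz => ->; rewrite mulr0.
  have := IH _ kl; have := hA _ _ lj; lia.
apply/matrixP => i j; rewrite [RHS]mxE; apply/eqP/negPn/negP => /H.
by have := hm j; lia.
Qed.

(** For a row eigenvector [v], the vectors a^k v - v A^k vanish at k = 0 and
satisfy a recursion whose inhomogeneous term is v E A^k, of norm at most
gam |v|. At k = m only a^m v is left. *)
Lemma eigenvalue_pow_le (C : numClosedFieldType) n (A E : 'M[C]_n) a m
    (gam : C) :
  (forall u : 'rV_n, l2norm (u *m A) <= l2norm u) ->
  (forall u : 'rV_n, l2norm (u *m E) <= l2norm u * gam) ->
  A ^+ m = 0 -> eigenvalue (A + E) a ->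
  `|a| ^+ m <= gam * \sum_(i < m) `|a| ^+ i.
Proof.
move=> hA hE Am /eigenvalueP[v vE v0].
have Ak k : l2norm (v *m E *m A ^+ k) <= l2norm v * gam.
  elim: k => [|k IH]; first by rewrite expr0 mulmx1.
  by rewrite exprSr mulmxA; apply: le_trans (hA _) IH.
have H k : l2norm (a ^+ k *: v - v *m A ^+ k) <=
    (\sum_(i < k) `|a| ^+ i) * (l2norm v * gam).
  elim: k => [|k IH].
    rewrite big_ord0 mul0r expr0 scale1r mulmx1 subrr.
    by rewrite -(scale0r 0) l2normZ normr0 mul0r.
  have -> : a ^+ k.+1 *: v - v *m A ^+ k.+1 =
      a *: (a ^+ k *: v - v *m A ^+ k) + v *m E *m A ^+ k.
    rewrite scalerBr scalerA -exprS -addrA; congr (_ + _).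
    rewrite scalemxAl -vE mulmxDr mulmxDl opprD addrNK exprS.
    by rewrite -mulmxE mulmxA.
  apply: le_trans (l2normD _ _ _ _) _; rewrite l2normZ.
  rewrite big_ord_recl expr0 mulrDl mul1r addrC.
  rewrite lerD//; under eq_bigr do rewrite /bump/= exprS.
  by rewrite -mulr_sumr -mulrA ler_wpM2l.
have vpos : 0 < l2norm v by rewrite sqrt_dnorm_gt0.
rewrite -(ler_pM2r vpos) -normrX -l2normZ (mulrC gam) -mulrA (mulrC gam).
by have := H m; rewrite Am mulmx0 subr0.
Qed.

(** * The block shift *)

Lemma sqr_hs_norm (R : realType) n (A : 'M[R[i]]_n) :
  (hs_norm A)%:C ^+ 2 = \sum_j \sum_i `|A i j| ^+ 2.
Proof.
have trE : \tr (map_mx Num.conj A^T *m A) = \sum_j \sum_i `|A i j| ^+ 2.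
  apply: eq_bigr => j _; rewrite mxE; apply: eq_bigr => i _.
  by rewrite !mxE normCK mulrC.
have tr0 : 0 <= \tr (map_mx Num.conj A^T *m A).
  by rewrite trE; do 2!apply: sumr_ge0 => ? _; rewrite exprn_ge0.
rewrite -trE /hs_norm -rmorphXn /= sqr_sqrtr ?RRe_real ?ger0_real//.
by move: tr0; rewrite lecE => /andP[].
Qed.

(** Reading off coefficients without the casts into ['I_b.+1]: inside one block,
consecutive remainders are the same as consecutive indices. *)
Lemma blockTE (R : realType) b N (i j : 'I_N) :
  blockT R b N i j = [&& i %/ b.+1 == j %/ b.+1, i %/ b.+1 < N %/ b.+1
                       & j == i.+1 :> nat]%N%:R.
Proof.
rewrite mxE andbA; case: ifP => //= /andP[/eqP ij _].
rewrite mxE !inordK ?ltn_mod//; congr (nat_of_bool _)%:R.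
by rewrite {2}(divn_eq i b.+1) {2}(divn_eq j b.+1) ij -addnS eqn_add2l.
Qed.

(** [eigenvalue_pow_le] at an eigenvalue of maximal modulus: the block shift is
a contraction, as the matrix of the partial injection i |-> i + 1. *)
Lemma spectral_radius_pow_le (R : realType) b N (E : 'M[R[i]]_N) m :
  (0 < N)%N -> blockT R b N ^+ m = 0 ->
  let r := spectral_radius (blockT R b N + E) in
  r ^+ m <= hs_norm E * \sum_(i < m) r ^+ i.
Proof.
move=> N0 Tm.
have [[a aE <-] _] := @spectral_radius_max R N (blockT R b N + E) N0.
have cabsE : (cabs a)%:C = `|a| by rewrite /cabs RRe_real// ger0_real.
rewrite /= -lecR rmorphM rmorph_sum rmorphXn /= cabsE.
under eq_bigr do rewrite rmorphXn /= cabsE.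
apply: eigenvalue_pow_le Tm aE => u.
  apply: (@l2norm_partial_perm_le _ _ _ _ _ _ _ (@blockTE R b N)).
    move=> i j j' /and3P[_ _ /eqP ji] /and3P[_ _ /eqP ji'].
    by apply: val_inj; rewrite /= ji ji'.
  move=> i i' j /and3P[_ _ /eqP ji] /and3P[_ _ /eqP ji'].
  by apply: val_inj; apply: succn_inj; rewrite -ji.
rewrite -ler_sqr ?nnegrE ?mulr_ge0 ?l2norm_ge0//; last first.
  by rewrite lecR sqrtr_ge0.
by rewrite exprMn sqr_hs_norm sqr_l2norm_mulmx_le.
Qed.

(** The block shift raises the position inside a block by one. *)
Lemma blockT_nilpotent (R : realType) b N : blockT R b N ^+ b.+1 = 0.
Proof.
apply: (@graded_nilpotent _ _ _ (fun i : 'I_N => i %% b.+1)%N) => [i|i j].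
  exact: ltn_pmod.
rewrite blockTE; case: and3P => [[/eqP ij _ /eqP ji] _|]; last by rewrite eqxx.
have := divn_eq i b.+1; have := divn_eq j b.+1; rewrite -ij; lia.
Qed.

Lemma blockT_small (R : realType) b N : (N < b.+1)%N -> blockT R b N = 0.
Proof.
by move=> Nb; apply/matrixP => i j; rewrite blockTE (divn_small Nb) andbF mxE.
Qed.

(** * From the power inequality to the radius *)

(** If r were at least 1, every r^i in the sum would be at most r^n, giving
r^n <= n e r^n < r^n. Once r < 1, every r^i is at most 1. *)
Lemma pow_le_lt1 (R : realFieldType) (r e : R) n :
  0 <= r -> 0 <= e -> n%:R * e < 1 -> r ^+ n <= e * \sum_(i < n) r ^+ i ->
  r < 1 /\ r ^+ n <= n%:R * e.
Proof.
move=> r0 e0 ne h.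
have r1 : r < 1.
  rewrite ltNge; apply/negP => r1.
  have : r ^+ n <= e * \sum_(i < n) r ^+ n.
    apply: le_trans h _; rewrite ler_wpM2l// ler_sum// => i _.
    by rewrite ler_weXn2l// ltnW.
  rewrite sumr_const card_ord -[_ *+ n]mulr_natl mulrA (mulrC e).
  rewrite -subr_le0 -[X in X - _]mul1r -mulrBl pmulr_lle0 ?subr_le0 ?leNgt ?ne//.
  by rewrite exprn_gt0// (lt_le_trans ltr01).
split => //; apply: le_trans h _; rewrite mulrC ler_wpM2r//.
apply: (@le_trans _ _ (\sum_(i < n) 1)).
  by apply: ler_sum => i _; rewrite exprn_ile1// ltW.
by rewrite sumr_const card_ord.
Qed.

(** If s < r, then s^b <= s^(b-1) r, so that the hypothesis gives
r^b <= s^(b-1). Every term r^(b-1-i) s^i of the factor in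
r^b - s^b = (r - s) sum_i r^(b-1-i) s^i is then at least r^b, hence
r^b >= (r - s) b r^b and r - s <= 1/b. *)
Lemma root_gap (R : realFieldType) (r s : R) b :
  (0 < b)%N -> 0 <= r < 1 -> 0 <= s -> r ^+ b.+1 <= s ^+ b ->
  r <= s + b%:R^-1.
Proof.
case: b => // b _ /andP[r0 r1] s0 h.
have [rs|sr] := leP r s; first by rewrite (le_trans rs)// lerDl invr_ge0.
have rp : 0 < r by apply: le_lt_trans sr.
have sb : r ^+ b.+1 <= s ^+ b.
  rewrite -(ler_pM2l rp) -exprS (le_trans h)// exprS ler_wpM2r ?exprn_ge0//.
  exact: ltW.
have : (r - s) * (b.+1%:R * r ^+ b.+1) <= r ^+ b.+1.
  apply: (@le_trans _ _ (r ^+ b.+1 - s ^+ b.+1)); last first.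
    by rewrite gerBl exprn_ge0.
  rewrite subrXX ler_wpM2l ?subr_ge0 ?(ltW sr)//.
  rewrite mulr_natl -[X in _ *+ X](card_ord b.+1) -sumr_const ler_sum// => i _ /=.
  apply: le_trans sb _; rewrite -{1}(subnK (ltnSE (ltn_ord i))) exprD.
  by rewrite ler_wpM2r ?exprn_ge0// lerXn2r ?nnegrE// ltW.
rewrite mulrA -[leRHS]mul1r ler_pM2r ?exprn_gt0// -ler_pdivlMr ?ltr0n// div1r.
by rewrite lerBlDl.
Qed.

Lemma inv_ge_ln_cvg0 (R : realType) (b : nat -> nat) :
  (forall N : nat, (0 < N)%N -> ln (N%:R : R) <= (b N)%:R) ->
  (b N)%:R^-1 @[N --> \oo] --> (0 : R).
Proof.
move=> hb.
have near_b (A : R) : \forall N \near \oo, A <= (b N)%:R.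
  near=> N; have N0 : (0 < N)%N by near: N; exact: nbhs_infty_gt.
  apply: le_trans (hb N N0); rewrite -(expRK A) ler_ln ?posrE ?expR_gt0 ?ltr0n//.
  by near: N; exact: nbhs_infty_ger.
apply/gtr0_cvgV0; last by apply/cvgryPge.
by near=> N; rewrite (lt_le_trans (@ltr01 R))//; near: N.
Unshelve. all: by end_near. Qed.

Theorem proposition7 (R : realType) (b : nat -> nat) (g : nat -> R)
    (RN : forall N : nat, 'M[R[i]]_N)
    (hb0 : forall N : nat, (0 < N)%N -> (0 < b N)%N)
    (hb : forall N : nat, (0 < N)%N -> ln (N%:R : R) <= (b N)%:R)
    (hR : forall N : nat, (0 < N)%N -> hs_norm (RN N) <= g N)
    (hg : forall N : nat, (0 < N)%N ->
      g N < 1 / (3 * (b N)%:R * Num.sqrt (N%:R : R))) :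
  exists eps : nat -> R, eps @ \oo --> (0 : R) /\
    forall N : nat, (0 < N)%N ->
      spectral_radius (blockT R (b N) N + RN N) <=
        (N%:R * g N) `^ (1 / (b N)%:R) + eps N.
Proof.
exists (fun N => (b N)%:R^-1); split; first exact: inv_ge_ln_cvg0.
move=> N N0; move: (b N) (g N) (RN N) (hb0 N N0) (hR N N0) (hg N N0).
move=> {hb0 hR hg hb RN}b {}g E b0 Eg hg.
have g0 : 0 <= g by apply: le_trans Eg; rewrite sqrtr_ge0.
(* The factor 3 leaves room for the step from b to b + 1 <= 2 b. *)
have g3 : 3 * b%:R * g < 1.
  have b3 : 0 < 3 * b%:R :> R by rewrite mulr_gt0 ?ltr0n.
  rewrite mulrC -ltr_pdivlMr//; apply: lt_le_trans hg _.
  rewrite ler_pM2l ?ltr01// lef_pV2 ?posrE ?mulr_gt0 ?sqrtr_gt0 ?ltr0n//.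
  by apply: ler_peMr; [exact: ltW|rewrite -[leLHS]sqrtr1 ler_wsqrtr// ler1n].
set r := spectral_radius _.
have r0 : 0 <= r.
  have [[a _ ra] _] := @spectral_radius_max R N (blockT R b N + E) N0.
  by rewrite /r -ra cabs_ge0.
have pow m : blockT R b N ^+ m = 0 -> r ^+ m <= g * \sum_(i < m) r ^+ i.
  move=> /(spectral_radius_pow_le R b N E m N0); rewrite -/r => /le_trans; apply.
  by rewrite ler_wpM2r// sumr_ge0// => i _; rewrite exprn_ge0.
have [bN|Nb] := leqP b.+1 N; last first.
  have := pow 1%N; rewrite expr1 blockT_small// => /(_ erefl).
  rewrite big_ord1 expr0 mulr1 expr1 => rg; apply: le_trans rg _.
  rewrite -[leLHS]add0r lerD ?powR_ge0// -[leRHS]mul1r ler_pdivlMr ?ltr0n//.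
  have : 0 <= b%:R * g by rewrite mulr_ge0.
  lra.
have b1 : (1 : R) <= b%:R by rewrite ler1n.
have [|r1 rb] := pow_le_lt1 _ _ _ _ r0 g0 _ (pow _ (blockT_nilpotent R b N)).
  have : g <= b%:R * g by rewrite ler_peMl.
  by rewrite -natr1 mulrDl mul1r; lra.
have Ng0 : 0 <= N%:R * g by rewrite mulr_ge0.
apply: root_gap; rewrite ?r0 ?powR_ge0//.
rewrite -(powR_mulrn _ (powR_ge0 _ _)) -powRrM div1r.
rewrite mulVf ?pnatr_eq0 -?lt0n// powRr1//.
by apply: le_trans rb _; rewrite ler_wpM2r// ler_nat.
Qed.
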